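(* Let $S$ be a range set. Then the following statements are equivalent: (1) the set $S$ has countable coinitiality; (2) for every topological space $X$ we have $\mathrm{UM}(X)\neq\emptyset$ if and only if $\mathrm{UM}(X,S)\neq\emptyset$.
   Context: A range set is a set $S\subseteq[0,\infty)$ with $0\in S$; it has countable coinitiality if there is a strictly decreasing sequence $\{r_i\}_{i\in\mathbb{N}}$ in $S$ with $\lim_{i\to\infty}r_i=0$. A metric $d$ on $X$ is an ultrametric if $d(x,y)\le \max\{d(x,z),d(z,y)\}$ for all $x,y,z$; it is $S$-valued if $d(X^2)\subseteq S$. For a topological space $X$, $\mathrm{UM}(X,S)$ denotes the set of all $S$-valued ultrametrics on $X$ that generate the topology of $X$, and $\mathrm{UM}(X)=\mathrm{UM}(X,[0,\infty))$. *)

(* Defs.v *)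
From HB Require Import structures.
From mathcomp Require Import all_boot all_order all_algebra.
From mathcomp Require Import all_classical all_reals all_analysis.

Set Implicit Arguments.
Unset Strict Implicit.
Unset Printing Implicit Defensive.

Import Order.TTheory GRing.Theory Num.Theory.
Import numFieldNormedType.Exports.

Local Open Scope classical_set_scope.
Local Open Scope ring_scope.

Definition range_set (R : realType) (S : set R) : Prop :=
  S `<=` `[0, +oo[ /\ S 0.

(* [decreasing_seq] is strict: it asks [r m <= r n] to be equivalent to
   [n <= m]. *)
Definition countable_coinitiality (R : realType) (S : set R) : Prop :=
  exists r : R^nat,
    [/\ forall i, S (r i), decreasing_seq r & r @ \oo --> 0].

(* The metrics of interest are functions on a fixed space, not a canonical
   [metricType] structure on it; the axioms are those of [isMetric],
   plus nonnegativity, which they imply. *)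
Definition metric (R : realType) (X : Type) (d : X -> X -> R) : Prop :=
  [/\ forall x y, 0 <= d x y,
      forall x y, d x y = 0 <-> x = y,
      forall x y, d x y = d y x
    & forall x y z, d x z <= d x y + d y z].

Definition ultrametric (R : realType) (X : Type) (d : X -> X -> R) : Prop :=
  metric d /\ forall x y z, d x y <= Num.max (d x z) (d z y).

Definition valued_in (R : realType) (X : Type) (S : set R)
    (d : X -> X -> R) : Prop :=
  forall x y, S (d x y).

Definition generates_topology (R : realType) (X : topologicalType)
    (d : X -> X -> R) : Prop :=
  forall A : set X,
    open A <->
    forall x, A x -> exists2 e : R, 0 < e & [set y | d x y < e] `<=` A.

Definition UM (R : realType) (X : topologicalType) (S : set R) :
    set (X -> X -> R) :=
  [set d | [/\ ultrametric d, valued_in S d & generates_topology d]].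
Arguments UM {R} X S.

(* Main.v *)
Require Import Defs.
From HB Require Import structures.
From mathcomp Require Import all_boot all_order all_algebra.
From mathcomp Require Import all_classical all_reals all_analysis.

(** For (1) => (2), replace an ultrametric [d] by [phi \o d], where [phi t] is
    the largest term of the sequence below [t]: [phi] is nondecreasing and
    vanishes only at [0], so [phi \o d] is an ultrametric, and it is
    topologically equivalent to [d] because [phi t <= t] while [phi t < r n]
    forces [t < r n].
    For (2) => (1), let [R] carry the ultrametric equal to [max |x| |y|] off the
    diagonal. There [0] is not isolated, so an [S]-valued ultrametric generating
    the same topology takes arbitrarily small positive values. *)

Import Order.TTheory GRing.Theory Num.Theory.
Import numFieldNormedType.Exports.

Local Open Scope classical_set_scope.
Local Open Scope ring_scope.

Lemma nondecreasing_ultrametric (R : realType) (X : Type) (d : X -> X -> R)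
    (phi : R -> R) :
    (forall s t, 0 <= s -> s <= t -> phi s <= phi t) ->
    phi 0 = 0 -> (forall t, 0 < t -> 0 < phi t) ->
  ultrametric d -> ultrametric (fun x y => phi (d x y)).
Proof.
move=> phi_mono phi0 phi_gt0 [[d_ge0 d_eq0 d_sym _] d_ultra].
have phi_ge0 x y : 0 <= phi (d x y) by rewrite -phi0 phi_mono.
have phi_ultra x y z : phi (d x y) <= Num.max (phi (d x z)) (phi (d z y)).
  have := d_ultra x y z; rewrite !le_max.
  by case/orP=> dxy; rewrite (phi_mono _ _ (d_ge0 x y) dxy) ?orbT.
split=> //; split=> //.
- move=> x y; split=> [phid0|->]; last by rewrite (d_eq0 y y).2.
  apply/d_eq0/eqP; apply: contra_eqT phid0 => dxy_neq0.
  by rewrite gt_eqF// phi_gt0// lt0r dxy_neq0 d_ge0.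
- by move=> x y; rewrite d_sym.
- move=> x y z; apply: le_trans (phi_ultra x z y) _.
  by rewrite ge_max lerDl lerDr !phi_ge0.
Qed.

Section round_down.
Context {R : realType} (r : R^nat).
Hypotheses (r_decr : decreasing_seq r) (r_cvg0 : r @ \oo --> 0).

(** The limit [0] bounds a nonincreasing sequence from below, so [r n.+1] is nonnegative, and strict
    decrease puts [r n] above it. *)
Lemma decreasing_cvg0_gt0 n : 0 < r n.
Proof.
apply: (@le_lt_trans _ _ (r n.+1)); last by rewrite ltNge r_decr ltnn.
rewrite -(cvg_lim _ r_cvg0)//; apply: nonincreasing_cvgn_ge.
  by move=> i j ij; rewrite r_decr.
by apply/cvg_ex; exists 0.
Qed.

Lemma cvg0_exists_lt e : 0 < e -> exists n, r n < e.
Proof.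
move=> e_gt0; have /cvgrPdist_lt/(_ e e_gt0)[N _ rN] := r_cvg0.
exists N; have := rN N (leqnn N).
by rewrite sub0r normrN; apply: le_lt_trans; exact: ler_norm.
Qed.

Lemma exists_round_down : exists phi : R -> R,
  [/\ phi 0 = 0,
      forall t, 0 < t -> range r (phi t),
      forall t, 0 <= t -> phi t <= t
    & forall n t, r n <= t -> r n <= phi t].
Proof.
have /choice[phi phiP] (t : R) : exists s : R,
    [/\ t = 0 -> s = 0, 0 < t -> range r s, 0 <= t -> s <= t
      & forall n, r n <= t -> r n <= s].
  have [t_gt0|t_le0] := ltP 0 t.
    have ex_n : exists n, r n <= t.
      by have [n /ltW] := cvg0_exists_lt _ t_gt0; exists n.
    (* As [r] decreases, the least index with [r n <= t] gives the largest such term. *)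
    have [n rn_le min_n] := ex_minnP ex_n; exists (r n); split=> //.
    - by move=> t0; rewrite t0 ltxx in t_gt0.
    - by move=> m /min_n; rewrite r_decr.
  (* For [t <= 0] the value is [0]; the last clause is then vacuous, every [r n] being positive. *)
  exists 0; split=> // n /le_trans/(_ t_le0).
  by rewrite leNgt decreasing_cvg0_gt0.
exists phi; split=> [|t|t|n t]; first by have [-> //] := phiP 0.
all: by have [_ pos le ge] := phiP t; first [exact: pos|exact: le|exact: ge].
Qed.

End round_down.

Lemma countable_coinitiality_UM (R : realType) (S : set R)
    (X : topologicalType) :
  range_set S -> countable_coinitiality S ->
  UM X (`[0, +oo[%classic : set R) !=set0 -> UM X S !=set0.
Proof.
move=> [_ S0] [r [rS r_decr r_cvg0]] [d [d_ultra _ d_open]].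
have [phi [phi0 phi_range phi_le phi_ge]] := exists_round_down r r_decr r_cvg0.
have r_gt0 := decreasing_cvg0_gt0 r r_decr r_cvg0.
have phi_gt0 t : 0 < t -> 0 < phi t by move=> /phi_range[n _ <-].
have [[d_ge0 _ _ _] _] := d_ultra.
exists (fun x y => phi (d x y)); split.
- apply: nondecreasing_ultrametric => // s t.
  rewrite le_eqVlt => /predU1P[<-|s_gt0 st].
    rewrite phi0 le_eqVlt => /predU1P[<-|/phi_gt0/ltW//].
    by rewrite phi0.
  (* [phi s] is itself a term [r n] with [r n <= s <= t], hence at most [phi t]. *)
  have [n _ rn] := phi_range s s_gt0.
  by rewrite -rn phi_ge// rn (le_trans (phi_le _ (ltW s_gt0))).
- move=> x y; have := d_ge0 x y; rewrite le_eqVlt => /predU1P[<-|].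
    by rewrite phi0.
  by move=> /phi_range[n _ <-].
- move=> A; rewrite d_open; split=> A_open x /A_open[e e_gt0 ballA].
    have [n rn_lt] := cvg0_exists_lt r r_cvg0 e e_gt0.
    exists (r n) => // y /= phid_lt; apply: ballA => /=.
    apply: lt_trans rn_lt; rewrite ltNge; apply/negP => /phi_ge.
    by rewrite leNgt phid_lt.
  by exists e => // y /= d_lt; apply: ballA; apply: le_lt_trans d_lt; exact: phi_le.
Qed.

(* An alias of [X]; the phantom argument [d] selects the topology instance. *)
Definition distance_space {R : realType} {X : choiceType}
  (d : X -> X -> R) : Type := X.

Section distance_space.
Context {R : realType} {X : choiceType} (d : X -> X -> R).

(** Worded as the right-hand side of [generates_topology], so that [d] generates the resulting
    topology by mere conversion. *)
Definition distance_open (A : set X) : Prop :=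
  forall x, A x -> exists2 e : R, 0 < e & [set y | d x y < e] `<=` A.

Lemma distance_openT : distance_open setT.
Proof. by move=> x _; exists 1. Qed.

Lemma distance_openI (A B : set X) :
  distance_open A -> distance_open B -> distance_open (A `&` B).
Proof.
move=> A_open B_open x [/A_open[e e_gt0 eA] /B_open[f f_gt0 fB]].
exists (Num.min e f); first by rewrite lt_min e_gt0.
by move=> y /=; rewrite lt_min => /andP[/eA ? /fB].
Qed.

Lemma distance_open_bigU (I : Type) (F : I -> set X) :
  (forall i, distance_open (F i)) -> distance_open (\bigcup_i F i).
Proof.
move=> F_open x [i _ /F_open[e e_gt0 eF]].
by exists e => // y /eF; exists i.
Qed.

HB.instance Definition _ := Choice.on (distance_space d).
HB.instance Definition _ := isOpenTopological.Build (distance_space d)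
  distance_openT distance_openI distance_open_bigU.

Lemma distance_space_generates : generates_topology (X := distance_space d) d.
Proof. by []. Qed.

End distance_space.

(** Each [x != 0] is isolated, its ball of radius [|x|] being a singleton, while the balls around
    [0] are the usual intervals; [0] is the only accumulation point. *)
Definition max_dist {R : realType} (x y : R) : R :=
  if x == y then 0 else Num.max `|x| `|y|.

Lemma max_dist_ultrametric (R : realType) : ultrametric (@max_dist R).
Proof.
have dist_ge0 (x y : R) : 0 <= max_dist x y.
  by rewrite /max_dist; case: ifP => // _; rewrite le_max normr_ge0.
have dist_ultra (x y z : R) :
    max_dist x y <= Num.max (max_dist x z) (max_dist z y).
  (* Once the coincidences are removed, [|x|] and [|y|] each occur on the right-hand side. *)
  have [<-|xy] := eqVneq x y; first by rewrite {1}/max_dist eqxx le_max dist_ge0.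
  have [<-|xz] := eqVneq x z; first by rewrite le_max lexx orbT.
  have [->|zy] := eqVneq z y; first by rewrite le_max lexx.
  rewrite /max_dist (negPf xy) (negPf xz) (negPf zy).
  by rewrite ge_max !le_max !lexx !orbT.
split=> //; split=> //.
- move=> x y; rewrite /max_dist; case: eqVneq => [//|xy]; split=> [max0|xy_eq].
    have /andP[/eqP x0 /eqP y0] : (x == 0) && (y == 0).
      by rewrite -!normr_le0 -ge_max max0.
    by rewrite x0 y0.
  by rewrite xy_eq eqxx in xy.
- by move=> x y; rewrite /max_dist eq_sym maxC.
- move=> x y z; apply: le_trans (dist_ultra x z y) _.
  by rewrite ge_max lerDl lerDr !dist_ge0.
Qed.

Lemma arbitrarily_small_coinitiality (R : realType) (S : set R) :
  (forall e, 0 < e -> exists s, [/\ S s, 0 < s & s < e]) ->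
  countable_coinitiality S.
Proof.
move=> S_small.
(* Guarding by [0 < e] makes the choice function total; its value [0] elsewhere is junk. *)
have /choice[f fP] (e : R) : exists s : R, 0 < e -> [/\ S s, 0 < s & s < e].
  have [/S_small[s sP]|] := ltP 0 e; first by exists s.
  by exists 0.
(* Staying below the previous term gives strict decrease; staying below [harmonic] forces the limit
   [0]. *)
pose r := fix r n :=
  if n is m.+1 then f (Num.min (r m) (harmonic m.+1)) else f (harmonic 0%N).
have harm_gt0 n : 0 < harmonic n :> R by rewrite /= invr_gt0.
have r_gt0 n : 0 < r n.
  elim: n => [|n rn_gt0] /=; first by have [] := fP _ (harm_gt0 0%N).
  by have [|//] := fP (Num.min (r n) (harmonic n.+1)); rewrite lt_min rn_gt0/=.
have min_gt0 n : 0 < Num.min (r n) (harmonic n.+1).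
  by rewrite lt_min r_gt0 harm_gt0.
exists r; split.
- by case=> [|n]; [have [] := fP _ (harm_gt0 0%N)|have [] := fP _ (min_gt0 n)].
- apply/decreasing_seqP => n.
  by have [_ _] := fP _ (min_gt0 n); rewrite lt_min => /andP[].
- apply: (@squeeze_cvgr _ _ _ _ (fun=> 0) harmonic); last exact: cvg_harmonic.
    near=> n; rewrite (ltW (r_gt0 n))/=.
    have : r n < harmonic n; last exact: ltW.
    case: (n) => [|m]; first by have [] := fP _ (harm_gt0 0%N).
    by have [_ _] := fP _ (min_gt0 m); rewrite lt_min => /andP[].
  exact: cvg_cst.
Unshelve. all: by end_near. Qed.

Lemma UM_max_dist_coinitiality (R : realType) (S : set R) :
  UM (distance_space (@max_dist R)) S !=set0 -> countable_coinitiality S.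
Proof.
move=> [d [[[d_ge0 d_eq0 _ _] _] dS d_open]].
apply: arbitrarily_small_coinitiality => e e_gt0; apply: contrapT => no_small.
(* Without values of [d] strictly between [0] and [e], the [d]-ball of radius [e] at [0] is a
   singleton. So the singleton of [0] is open and contains a [max_dist]-ball, of radius [e']. *)
have /d_open/distance_space_generates/(_ 0 erefl)[e' e'_gt0 e'0] :
    forall x, [set (0 : R)] x ->
      exists2 e : R, 0 < e & [set y | d x y < e] `<=` [set (0 : R)].
  move=> _ ->; exists e => // y /= d_lt; apply/esym/d_eq0.
  apply: contrapT => /eqP d_neq0; apply: no_small; exists (d 0 y).
  by rewrite lt0r d_neq0 d_ge0; split.
(* The nonzero point [e' / 2] lies in that ball, a contradiction. *)
have e2_gt0 : 0 < e' / 2 by rewrite divr_gt0.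
have e2_eq0 : e' / 2 = 0.
  apply: e'0; rewrite /= /max_dist lt_eqF// normr0 gtr0_norm//.
  by rewrite gt_max e'_gt0 ltr_pdivrMr// ltr_pMr// ltr1n.
by rewrite e2_eq0 ltxx in e2_gt0.
Qed.

Theorem proposition2p14 (R : realType) (S : set R) (hS : range_set S) :
  countable_coinitiality S <->
  (forall X : topologicalType,
     UM X (`[0, +oo[%classic : set R) !=set0 <-> UM X S !=set0).
Proof.
split=> [S_coinit X|UM_iff].
  split; first exact: countable_coinitiality_UM.
  by move=> [d [d_ultra dS d_open]]; exists d; split=> // x y; exact: hS.1.
(* The equivalence is used only for this one space, where [max_dist] itself shows that the
   unrestricted set is nonempty. *)
apply/UM_max_dist_coinitiality/UM_iff; exists max_dist.
split; [exact: max_dist_ultrametric| |exact: distance_space_generates].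
by move=> x y; rewrite /= in_itv/= andbT; case: (max_dist_ultrametric R) => -[].
Qed.
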